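(* Let $K$ be a field, let $r\ge 3$ be an integer, let $R=K[x_1,\dots,x_r]$, and let $I_{r,r}=(x_1^r,\dots,x_r^r,\,x_1x_2\cdots x_r)\subset R$. Then the level Artinian algebra $R/I_{r,r}$ fails to have the Weak Lefschetz property.
   Context: A standard graded Artinian $K$-algebra $A$ has the Weak Lefschetz property (WLP) if there is a linear form $L\in A_1$ such that for all integers $j$ the multiplication map $\times L: A_{j-1}\to A_j$ has maximal rank, i.e. is injective or surjective. An Artinian algebra is level if its socle is concentrated in one degree. The field $K$ is arbitrary (any characteristic). *)

(* Defs.v *)
From HB Require Import structures.
From mathcomp Require Import all_boot all_order all_algebra generic_quotient ring_quotient.
From mathcomp Require Import boolp.
From mathcomp Require Import mpoly.

Set Implicit Arguments.
Unset Strict Implicit.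
Unset Printing Implicit Defensive.

Import GRing.Theory.
Local Open Scope ring_scope.
Local Open Scope quotient_scope.

(* Membership in an ideal given by generators is made boolean classically,
   because [ideal_quot] expects a boolean predicate. *)
Definition ideal_gen (R : comNzRingType) (gs : seq R) : {pred R} :=
  fun p => `[< exists c : R -> R, p = \sum_(g <- gs) c g * g >].

Lemma ideal_genP (R : comNzRingType) (gs : seq R) (p : R) :
  reflect (exists c : R -> R, p = \sum_(g <- gs) c g * g) (p \in ideal_gen gs).
Proof. exact: asboolP. Qed.

Definition ideal_prop (R : pzRingType) (J : R -> Prop) : Prop :=
  J 0 /\ forall a u v : R, J u -> J v -> J (a * u + v).

Definition artinian (R : comPzRingType) : Prop :=
  forall J : nat -> R -> Prop,
    (forall n, ideal_prop (J n)) ->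
    (forall n a, J n.+1 a -> J n a) ->
    exists N : nat, forall n, (N <= n)%N -> forall a, J n a <-> J N a.

Section StandardGradedAlgebra.

Variables (K : fieldType) (n : nat) (I : idealr {mpoly K[n]}).

(* The degree d component of K[x_1, ..., x_n] / I. These components are the
   standard grading of the quotient when I is a homogeneous ideal. *)
Definition graded_piece (d : nat) (a : {ideal_quot I}) : Prop :=
  exists2 p : {mpoly K[n]}, p \is d.-homog & a = \pi_({ideal_quot I}) p.

(* Annihilator of the ideal spanned by the components of positive degree. *)
Definition socle (a : {ideal_quot I}) : Prop :=
  forall (d : nat) (b : {ideal_quot I}),
    (0 < d)%N -> graded_piece d b -> b * a = 0.

Definition level : Prop :=
  exists e : nat, forall a, socle a -> graded_piece e a.

Definition mul_injective_on (d : nat) (l : {ideal_quot I}) : Prop :=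
  forall a b, graded_piece d a -> graded_piece d b -> l * a = l * b -> a = b.

Definition mul_surjective_on (d : nat) (l : {ideal_quot I}) : Prop :=
  forall b, graded_piece d.+1 b -> exists2 a, graded_piece d a & l * a = b.

(* The maps A_(j-1) -> A_j with j <= 0 start from the zero space and are
   injective, so the index d = j - 1 ranges over the naturals. *)
Definition weak_lefschetz : Prop :=
  exists2 l, graded_piece 1 l &
    forall d : nat, mul_injective_on d l \/ mul_surjective_on d l.

End StandardGradedAlgebra.

Section MonomialIdeal.

Variables (K : fieldType) (r : nat).

Definition I_rr_gens : seq {mpoly K[r]} :=
  rcons [seq 'X_i ^+ r | i <- enum 'I_r] (\prod_(i < r) 'X_i).

Definition I_rr : {pred {mpoly K[r]}} := ideal_gen I_rr_gens.

Lemma I_rr_gens_meval0 (g : {mpoly K[r]}) :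
  (0 < r)%N -> g \in I_rr_gens -> g.@[fun=> 0] = 0.
Proof.
move=> r_gt0; rewrite mem_rcons inE => /predU1P[->|/mapP[i _ ->]].
  rewrite rmorph_prod /=; apply/eqP/prodf_eq0.
  by exists (Ordinal r_gt0); rewrite // mevalXU.
by rewrite rmorphXn /= mevalXU expr0n eqn0Ngt r_gt0.
Qed.

Lemma I_rr_idealr_closed : (2 < r)%N -> idealr_closed I_rr.
Proof.
move=> r_gt2; split=> [||a u v].
- by apply/ideal_genP; exists (fun=> 0); rewrite big1 // => g _; rewrite mul0r.
- apply/ideal_genP => -[c /(congr1 (meval (fun=> 0)))].
  rewrite meval1 rmorph_sum /= big_seq big1 => [/eqP|g g_in].
    by rewrite oner_eq0.
  by rewrite rmorphM /= (I_rr_gens_meval0 _ g_in) ?mulr0 //; case: (r) r_gt2.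
- case/ideal_genP=> c -> /ideal_genP[c' ->]; apply/ideal_genP.
  exists (fun g => a * c g + c' g); rewrite mulr_sumr -big_split /=.
  by apply: eq_bigr => g _; rewrite mulrDl mulrA.
Qed.

(* The lower bound on r is an argument because {ideal_quot _} requires a proof
   that the ideal is proper. *)
Definition I_rr_ideal (r_gt2 : (2 < r)%N) : idealr {mpoly K[r]} :=
  HB.pack I_rr (isIdealr.Build {mpoly K[r]} I_rr (I_rr_idealr_closed r_gt2)).

End MonomialIdeal.

Arguments I_rr_ideal K {r} r_gt2.

(* Main.v *)
From HB Require Import structures.
Require Import Defs.
From mathcomp Require Import all_boot all_order all_algebra ring_quotient.
From mathcomp Require Import perm generic_quotient boolp zify.
From mathcomp Require Import mpoly.

(* Let [d = 'C(r, 2)], let [A] be the quotient and [l = \sum_i c_i x_i].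
   The map [l : A_(d-1) -> A_d] is neither surjective nor injective.

   When all [c_i] are nonzero, the functional on [A_d] sending [x^m] to the
   sign of [m] times [\prod_i c_i^(- m_i)] if [m] is a permutation of
   (0, ..., r - 1), and to 0 otherwise, is well defined and vanishes on
   [l * A_(d-1)] because it is alternating.  In general only the variables with
   [c_i != 0] are permuted, with exponents 0, ..., k - 1, the others having
   fixed distinct exponents k, ..., r - 1.

   For injectivity it is enough that [dim A_d <= dim A_(d-1)].  Let [p_s(t)] be
   the coefficient of [X^t] in [(X + ... + X^(r-1))^s].  Sorting monomials by
   support, [dim A_t = \sum_(s < r) 'C(r, s) p_s(t)].  As [p_s] is symmetric
   and unimodal about [s r / 2], it decreases from [d - 1] to [d] for
   [s <= r - 2], while [p_(r-1)(d) - p_(r-1)(d-1) = p_(r-2)(d-1) - p_(r-2)(d)].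
   The increase at [s = r - 1] is compensated by the decrease at [s = r - 2]
   since [r <= 'C(r, 2)]. *)

Set Implicit Arguments.
Unset Strict Implicit.
Unset Printing Implicit Defensive.

Import GRing.Theory Num.Theory Order.TTheory.
Local Open Scope ring_scope.
Local Open Scope quotient_scope.

(** * Dimensions of the graded pieces *)

(** Symmetry about n/2 and unimodality in one condition; doubling [t] allows a half-integral
    centre. *)
Definition sym_unimodal (n : int) (f : int -> int) : Prop :=
  forall t u : int, `|t *+ 2 - n| <= `|u *+ 2 - n| -> f u <= f t.

(** The effect on coefficients of multiplication by X + ... + X^m. *)
Definition window (m : nat) (f : int -> int) (t : int) : int :=
  \sum_(k < m) f (t - k.+1%:Z).

Lemma window_succ m f t :
  window m f (t + 1) + f (t - m%:Z) = f t + window m f t.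
Proof.
rewrite /window.
have -> : \sum_(k < m) f (t + 1 - k.+1%:Z) = \sum_(k < m) f (t - k%:Z).
  by apply: eq_bigr => k _; congr f; lia.
have := @big_ord_recr _ 0 +%R m (fun k : 'I_m.+1 => f (t - k%:Z)).
move=> /= <-; rewrite big_ord_recl /=; congr (f _ + _); lia.
Qed.

Lemma sym_unimodal_sym n f t : sym_unimodal n f -> f (n - t) = f t.
Proof. by move=> Hf; apply/eqP; rewrite eq_le !Hf //; lia. Qed.

(** By symmetry it suffices to look right of the new centre. There a step from [t] to [t + 1]
    changes the window by [f t - f (t - m)], which is nonpositive because [t] is at least as far
    from n/2 as [t - m]. *)
Lemma sym_unimodal_window m n f :
  sym_unimodal n f -> sym_unimodal (n + m.+1%:Z) (window m f).
Proof.
move=> Hf.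
have symg t : window m f (n + m.+1%:Z - t) = window m f t.
  rewrite /window (reindex_inj rev_ord_inj); apply: eq_bigr => k _.
  rewrite -[RHS](sym_unimodal_sym _ Hf) /=; congr f.
  by have := ltn_ord k; lia.
have decr t (j : nat) : n + m.+1%:Z <= t *+ 2 ->
    window m f (t + j%:Z) <= window m f t.
  move=> ht; elim: j => [|j IHj]; first by rewrite addr0.
  apply: le_trans IHj.
  have -> : t + j.+1%:Z = t + j%:Z + 1 by lia.
  rewrite -(lerD2r (f (t + j%:Z - m%:Z))) window_succ addrC lerD2l.
  by apply: Hf; lia.
have upper t : exists2 t', window m f t' = window m f t &
    t' *+ 2 - (n + m.+1%:Z) = `|t *+ 2 - (n + m.+1%:Z)|.
  case: (lerP (n + m.+1%:Z) (t *+ 2)) => ht.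
    by exists t => //; lia.
  by exists (n + m.+1%:Z - t); rewrite ?symg //; lia.
move=> t u; have [t' <- ht] := upper t; have [u' <- hu] := upper u.
rewrite -ht -hu => le_tu.
have -> : u' = t' + `|u' - t'|%N%:Z by lia.
by apply: decr; lia.
Qed.

(** Coefficients extended by zero to negative indices, so that shifts and reflections need no
    truncated subtraction. *)
Definition zcoef (p : {poly int}) (t : int) : int :=
  if t is Posz n then p`_n else 0.

Arguments zcoef : simpl never.

Definition pospoly (m : nat) : {poly int} := \sum_(k < m) 'X^(k.+1).

Lemma zcoef_pospolyM m p t :
  zcoef (pospoly m * p) t = window m (zcoef p) t.
Proof.
rewrite {1}/zcoef; case: t => n; last first.
  by rewrite /window big1.
rewrite /pospoly mulr_suml coef_sum; apply: eq_bigr => k _.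
rewrite coefXnM; case: ltnP => h; rewrite /zcoef.
  by case E: (_ - _) => [j|//]; lia.
by case E: (_ - _) => [j|//]; [congr (p`_ _); lia|lia].
Qed.

Lemma sym_unimodal_pospolyX m s :
  sym_unimodal (s * m.+1)%:Z (zcoef (pospoly m ^+ s)).
Proof.
elim: s => [|s IHs].
  move=> t u; rewrite expr0 /zcoef.
  by case: t => [[|t]|t]; case: u => [[|u]|u] //=; rewrite ?coef1 //=; lia.
have := sym_unimodal_window (m := m) IHs; rewrite exprS.
have -> : (s * m.+1)%:Z + m.+1%:Z = (s.+1 * m.+1)%:Z by lia.
by move=> H t u h; rewrite !zcoef_pospolyM; apply: H.
Qed.

Definition reduced_exponents r d : {set {ffun 'I_r -> 'I_r}} :=
  [set a : {ffun 'I_r -> 'I_r} |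
    [exists i, a i == 0%N :> nat] && (\sum_i a i == d)%N].

(** With P = [pospoly m], the power (1 + P)^(m+1) enumerates all exponent vectors by degree. In its
    binomial expansion the term of index s collects the vectors with s nonzero entries, and dropping
    P^(m+1) removes those without a zero entry. *)
Lemma card_reduced_exponents m d :
  #|reduced_exponents m.+1 d|%:Z =
  \sum_(s < m.+1) zcoef (pospoly m ^+ s) d%:Z *+ 'C(m.+1, s).
Proof.
pose Q : {poly int} := \sum_(k < m.+1) 'X^k.
have QE : Q = 1 + pospoly m by rewrite /Q big_ord_recl.
have PE : pospoly m = \sum_(k < m.+1 | k != 0%N :> nat) 'X^k.
  by rewrite [RHS]big_mkcond big_ord_recl /= add0r.
have sumX (a : {ffun 'I_m.+1 -> 'I_m.+1}) :
    \prod_i ('X^(a i) : {poly int}) = 'X^(\sum_i a i).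
  elim/big_rec2: _ => // i n y _ ->; by rewrite exprD.
have E1 : Q ^+ m.+1 = \sum_(a : {ffun 'I_m.+1 -> 'I_m.+1}) 'X^(\sum_i a i).
  rewrite -{1}(card_ord m.+1) -prodr_const bigA_distr_bigA /=.
  exact: eq_bigr.
have E2 : pospoly m ^+ m.+1 =
    \sum_(a : {ffun 'I_m.+1 -> 'I_m.+1} | ~~ [exists i, a i == 0%N :> nat])
       'X^(\sum_i a i).
  rewrite -{1}(card_ord m.+1) -prodr_const PE bigA_distr_big /=.
  apply: eq_big => // a; rewrite negb_exists.
  by apply/ffun_onP/forallP.
have E3 : \sum_(s < m.+1) pospoly m ^+ s *+ 'C(m.+1, s) =
    \sum_(a : {ffun 'I_m.+1 -> 'I_m.+1} | [exists i, a i == 0%N :> nat])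
       'X^(\sum_i a i).
  apply: (addIr (pospoly m ^+ m.+1)); rewrite {2}E2.
  transitivity (Q ^+ m.+1); last first.
    pose has0 (a : {ffun 'I_m.+1 -> 'I_m.+1}) := [exists i, a i == 0%N :> nat].
    by rewrite E1 (bigID has0).
  rewrite QE exprDn.
  rewrite [RHS]big_ord_recr /= expr1n mul1r binn; congr (_ + _).
  by apply: eq_bigr => s _; rewrite expr1n mul1r.
transitivity ((\sum_(s < m.+1) pospoly m ^+ s *+ 'C(m.+1, s))`_d).
  rewrite E3 coef_sum -natz -sum1_card natr_sum big_mkcond [RHS]big_mkcond.
  apply: eq_bigr => a _; rewrite inE coefXn eq_sym.
  by case: ([exists _, _]) => //=; case: eqP.
by rewrite coef_sum; apply: eq_bigr => s _; rewrite coefMn /zcoef.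
Qed.

Lemma leq_bin2 r : (3 <= r)%N -> (r <= 'C(r, 2))%N.
Proof.
by move=> hr; rewrite bin2 -{1}(doubleK r) half_leq // -muln2 leq_mul2l; lia.
Qed.

Lemma leq_card_reduced_exponents r (d := 'C(r, 2)) : (3 <= r)%N ->
  (#|reduced_exponents r d| <= #|reduced_exponents r d.-1|)%N.
Proof.
move=> hr; have hd : (d * 2 = r * r.-1)%N.
  rewrite /d muln2 bin2 even_halfK //.
  by case: (r) => // n; rewrite oddM /= andNb.
have d_gt : (r <= d)%N by apply: leq_bin2.
case: r hr @d hd d_gt => [|[|s]] // hr d hd d_gt.
have bin_s : 'C(s.+2, s) = d.
  by rewrite /d -(bin_sub (m := 2)) // !subSS subn0.
rewrite -lez_nat !card_reduced_exponents; clearbody d.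
have Hp k := @sym_unimodal_pospolyX s.+1 k.
have Hd k : (k <= s)%N -> (k * s.+2 + s.+2 <= d * 2)%N.
  by move=> hk; rewrite -mulSnr hd mulnC leq_mul2l.
have decr k : (k <= s)%N ->
    zcoef (pospoly s.+1 ^+ k) d <= zcoef (pospoly s.+1 ^+ k) d.-1%:Z.
  by move=> /Hd hk; apply: Hp; move: (k * s.+2)%N hk => x; lia.
(* Here r is [s.+2]: the summands of index r - 2 and r - 1 are split off, and the others decrease
   termwise. *)
rewrite !(big_ord_recr s.+1) !(big_ord_recr s) /= -!addrA.
apply: lerD.
  by apply: ler_sum => k _; rewrite ler_wMn2r // decr // ltnW.
rewrite bin_s binSn.
have := window_succ s.+1 (zcoef (pospoly s.+1 ^+ s)) d.-1%:Z.
rewrite -!zcoef_pospolyM -!exprS.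
have -> : d.-1%:Z + 1 = d by lia.
(* The lower end of the window is the mirror image of [d], since 2d = s(s+2) + (s+2). *)
have -> : zcoef (pospoly s.+1 ^+ s) (d.-1%:Z - s.+1%:Z) =
          zcoef (pospoly s.+1 ^+ s) d%:Z.
  rewrite -(sym_unimodal_sym _ (Hp s)); congr zcoef.
  have : (s * s.+2 + s.+2 = d * 2)%N by rewrite hd -mulSnr mulnC.
  by move: (s * s.+2)%N => x; lia.
have := decr s (leqnn s).
set x := zcoef (_ ^+ s) d; set y := zcoef (_ ^+ s) d.-1%:Z.
set z := zcoef _ d; set w := zcoef _ d.-1%:Z => le_xy eq_zx.
have -> : z = w + (y - x).
  by apply: (addIr x); rewrite eq_zx -addrA subrK addrC.
(* What remains is that r copies of [y - x] are at most [d] copies. *)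
rewrite mulrnDl [leRHS]addrC [leLHS]addrCA lerD2l -lerBrDl -mulrnBl.
by rewrite ler_wpMn2l // subr_ge0.
Qed.

(** * A functional killing the multiples of a linear form *)

Definition reduced_mnm r (m : 'X_{1..r}) : bool :=
  [forall i, (m i < r)%N] && [exists i, m i == 0%N].

Definition ffun_mnm r (a : {ffun 'I_r -> 'I_r}) : 'X_{1..r} :=
  [multinom (a i : nat) | i < r].

Lemma ffun_mnm_inj r : injective (@ffun_mnm r).
Proof.
move=> a b /mnmP eq_ab; apply/ffunP => i; apply: val_inj.
by have := eq_ab i; rewrite !mnmE.
Qed.

Lemma reduced_ffun_mnm r (m : 'X_{1..r}) :
  reduced_mnm m -> exists a, m = ffun_mnm a.
Proof.
case/andP => /forallP m_lt _; exists [ffun i => Ordinal (m_lt i)].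
by apply/mnmP => i; rewrite mnmE ffunE.
Qed.

Lemma mem_reduced_exponents r (a : {ffun 'I_r -> 'I_r}) d :
  (a \in reduced_exponents r d) =
  reduced_mnm (ffun_mnm a) && (mdeg (ffun_mnm a) == d).
Proof.
rewrite inE mdegE /reduced_mnm.
have -> : [forall i, ffun_mnm a i < r]%N by apply/forallP => i; rewrite mnmE.
congr (_ && (_ == d)); first by apply: eq_existsb => i; rewrite mnmE.
by apply: eq_bigr => i _; rewrite mnmE.
Qed.

(** Jacobi's formula for the derivative of the determinant at [U] in direction [V]: the cofactors
    along the replaced row are those of [U]. *)
Lemma sum_det_row_replace (R : comNzRingType) n (U V : 'M[R]_n) :
  \sum_i \det (\matrix_(k, j) (if k == i then V k j else U k j)) =
  \tr (V *m \adj U).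
Proof.
apply: eq_bigr => i _; rewrite (expand_det_row _ i) mxE; apply: eq_bigr => j _.
rewrite !mxE eqxx; congr (_ * _); rewrite /cofactor; congr (_ * \det _).
by apply/matrixP=> k l; rewrite !mxE eq_sym (negPf (neq_lift _ _)).
Qed.

(** Each index is sent to its position in a list that enumerates [S] first and then its
    complement. *)
Lemma perm_initial r (S : {set 'I_r}) :
  exists s : {perm 'I_r}, forall i, (s i < #|S|)%N = (i \in S).
Proof.
pose e := enum S ++ enum (~: S).
have e_uniq : uniq e.
  rewrite cat_uniq !enum_uniq andbT /=; apply/hasPn => i.
  by rewrite !mem_enum inE.
have mem_e i : i \in e by rewrite mem_cat !mem_enum inE orbN.
have size_e : size e = r by rewrite size_cat -!cardE cardsC card_ord.
have lt_e i : (index i e < r)%N by rewrite -[X in (_ < X)%N]size_e index_mem.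
have inj : injective (fun i => Ordinal (lt_e i)).
  by move=> i j [] /(congr1 (nth i e)); rewrite !nth_index.
exists (perm inj) => i; rewrite permE /= index_cat mem_enum cardE.
by case: ifP => iS; rewrite ?index_mem ?mem_enum // ltnNge leq_addr.
Qed.

Section AlternatingFunctional.

Variables (K : fieldType) (r : nat) (c : 'I_r -> K) (s : {perm 'I_r}) (k : nat).
Hypothesis s_lt : forall i, (s i < k)%N = (c i != 0).

Definition exponent_weight (i j : 'I_r) : K :=
  if c i == 0 then (j == s i)%:R else (j < k)%N%:R * c i ^- j.

(** Row i has at most one nonzero entry, in column [m i], so the determinant is the signed product
    of weights when [m] permutes 0, ..., r - 1, and 0 otherwise. This is the value of the functional
    at x^m. *)
Definition exponent_mx (m : 'X_{1..r}) : 'M[K]_r :=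
  \matrix_(i, j) ((m i == j)%:R * exponent_weight i j).

Definition shift_mx : 'M[K]_r := \matrix_(i, j) ((i.+1 == j) && (j < k)%N)%:R.

(** If [c i] is nonzero, it cancels one factor of the weight. If [c i] is 0, the only exponent with
    nonzero weight is [s i], which is at least [k], and [shift_mx] kills it. *)
Lemma exponent_mx_row m i j :
  c i * exponent_mx (m + U_(i)) i j = (exponent_mx m *m shift_mx) i j.
Proof.
rewrite [RHS]mxE mxE mnmDE mnm1E eqxx addn1.
under eq_bigr => l _ do rewrite !mxE.
have [Ej|neq_j] := eqVneq (m i).+1 (j : nat); last first.
  rewrite mul0r mulr0 big1 // => l _.
  have [El|] := eqVneq (m i) (l : nat); last by rewrite !mul0r.
  by rewrite -El (negPf neq_j) mulr0.
have lt_mi : (m i < r)%N by rewrite ltnW // Ej ltn_ord.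
rewrite (bigD1 (Ordinal lt_mi)) //= eqxx !mul1r Ej eqxx /=.
rewrite big1 ?addr0; last first.
  move=> l; rewrite -val_eqE eq_sym /= => /negPf->; by rewrite !mul0r.
rewrite /exponent_weight; case: eqP => [c0|/eqP c_neq0].
  rewrite c0 mul0r -val_eqE /=; case: eqP => [Ei|]; last by rewrite mul0r.
  have := s_lt i; rewrite c0 eqxx => hk.
  by rewrite (_ : (j < k)%N = false) ?mulr0 //; lia.
rewrite /= -Ej exprSr; case: (ltnP _ k) => hk; last by rewrite mul0r !mulr0.
by rewrite (ltnW hk) !mul1r mulr1 invfM mulrA mulrAC mulfV // mul1r.
Qed.

Lemma shift_mx_trace : \tr shift_mx = 0.
Proof. by rewrite /mxtrace big1 // => i _; rewrite mxE gtn_eqF. Qed.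

(* Scaling row i of [exponent_mx (m + U_(i))] by [c i] turns it into row i of
   [exponent_mx m *m shift_mx], so the sum is
   [\tr shift_mx * \det (exponent_mx m)]. *)
Lemma sum_det_exponent_mx m : \sum_i c i * \det (exponent_mx (m + U_(i))) = 0.
Proof.
transitivity (\tr (exponent_mx m *m shift_mx *m \adj (exponent_mx m))).
  rewrite -sum_det_row_replace; apply: eq_bigr => i _.
  rewrite !(expand_det_row _ i) mulr_sumr; apply: eq_bigr => j _.
  rewrite mulrA exponent_mx_row [in RHS]mxE eqxx; congr (_ * _).
  rewrite /cofactor; congr (_ * \det _); apply/matrixP=> a b; rewrite !mxE.
  by rewrite mnmDE mnm1E [lift i a == i]eq_sym (negPf (neq_lift i a)) addn0.
rewrite -mulmxA mxtrace_mulC -mulmxA mul_adj_mx mul_mx_scalar mxtraceZ.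
by rewrite shift_mx_trace mulr0.
Qed.

Lemma det_exponent_mx_neq0 :
  \det (exponent_mx [multinom (s i : nat) | i < r]) != 0.
Proof.
have -> : exponent_mx [multinom (s i : nat) | i < r] =
    diag_mx (\row_i exponent_weight i (s i)) *m perm_mx s.
  apply/matrixP=> i j; rewrite mul_diag_mx !mxE mnmE.
  have [->|neq] := eqVneq (s i) j; first by rewrite eqxx mul1r mulr1.
  by rewrite (_ : (s i : nat) == j = false) ?mul0r ?mulr0 //; exact: negPf.
rewrite det_mulmx det_diag det_perm mulf_neq0 ?signr_eq0 //.
apply/prodf_neq0 => i _; rewrite mxE /exponent_weight.
have [_|c_neq0] := eqVneq (c i) 0; first by rewrite eqxx oner_neq0.
by rewrite s_lt c_neq0 mul1r invr_neq0 // expf_neq0.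
Qed.

(** No row vanishes, so every exponent is below [r]; no column vanishes, so every value below [r]
    occurs. Hence [m] is a permutation of 0, ..., r - 1. *)
Lemma det_exponent_mx_support m : (0 < r)%N -> \det (exponent_mx m) != 0 ->
  reduced_mnm m /\ mdeg m = 'C(r, 2).
Proof.
move=> r_gt0 det_neq0.
have lt_m i : (m i < r)%N.
  rewrite ltnNge; apply: contra det_neq0 => le_r.
  rewrite (expand_det_row _ i) big1 // => j _; rewrite mxE.
  by rewrite gtn_eqF ?mul0r // (leq_trans (ltn_ord j)).
pose f i := Ordinal (lt_m i).
have f_surj j : exists i, f i == j.
  apply/existsP; apply: contraR det_neq0; rewrite negb_exists => /forallP hf.
  rewrite (expand_det_col _ j) big1 // => i _; rewrite mxE.
  by have := hf i; rewrite -val_eqE /= => /negPf->; rewrite !mul0r.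
split.
  apply/andP; split; first exact/forallP.
  have [i hi] := f_surj (Ordinal r_gt0).
  by apply/existsP; exists i; rewrite -val_eqE in hi.
have f_inj : injective f.
  apply/injectiveP/card_uniqP; rewrite size_map -cardE card_ord -[RHS]card_ord.
  apply: eq_card => j; have [i /eqP <-] := f_surj j.
  by rewrite !inE map_f // mem_enum.
rewrite mdegE -bin2_sum big_mkord [RHS](reindex_inj f_inj).
by apply: eq_bigr.
Qed.

End AlternatingFunctional.

Lemma alternating_functional_exists (K : fieldType) r (c : 'I_r -> K) :
  (0 < r)%N -> exists phi : 'X_{1..r} -> K,
  [/\ exists m, phi m != 0,
      forall m, phi m != 0 -> reduced_mnm m /\ mdeg m = 'C(r, 2)
    & forall m, \sum_i c i * phi (m + U_(i))%MM = 0].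
Proof.
move=> r_gt0; have [s hs] := perm_initial [set i | c i != 0].
have s_lt i : (s i < #|[set i | c i != 0%R]|)%N = (c i != 0) by rewrite hs inE.
exists (fun m => \det (exponent_mx c s #|[set i | c i != 0%R]| m)).
split=> [|m|m].
- by eexists; apply: (det_exponent_mx_neq0 s_lt).
- exact: det_exponent_mx_support.
- exact: (sum_det_exponent_mx s_lt).
Qed.

(** * Linear algebra *)

(** Among the matrices with row space inside [W], one of maximal rank works: adjoining a vector of
    [W] cannot raise its rank. *)
Lemma subspace_mx_exists (F : fieldType) n (W : 'rV[F]_n -> Prop) :
  W 0 -> (forall c u v, W u -> W v -> W (c *: u + v)) ->
  exists M : 'M_n, forall v, W v <-> (v <= M)%MS.
Proof.
move=> W0 Wlin.
pose inW k := `[< exists M : 'M_n,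
  (forall v, (v <= M)%MS -> W v) /\ \rank M = k >].
have ex_k : exists k, inW k.
  exists 0%N; apply/asboolP; exists 0; split; last exact: mxrank0.
  by move=> v; rewrite submx0 => /eqP->.
have ub_k k : inW k -> (k <= n)%N.
  by move/asboolP=> [M [_ <-]]; exact: rank_leq_row.
case: (ex_maxnP ex_k ub_k) => k /asboolP[M [MW rkM]] k_max.
exists M => v; split=> [Wv|]; last exact: MW.
have inW_sum : inW (\rank (M + v)%MS).
  apply/asboolP; exists (M + v)%MS; split=> // w /sub_addsmxP[u ->].
  rewrite addrC (mx11_scalar u.2) mul_scalar_mx; apply: Wlin => //.
  by apply: MW; exact: submxMl.
have := k_max _ inW_sum.
rewrite -rkM (geq_leqif (mxrank_leqif_sup (addsmxSl M v))).
by apply: submx_trans; exact: addsmxSr.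
Qed.

(** Ideals pull back along [f] to subspaces, and a descending chain is constant from any term of
    minimal rank. *)
Lemma artinian_finite_dim (A : comPzRingType) (F : fieldType) n
    (f : 'rV[F]_n -> A) :
  {morph f : u v / u + v} ->
  (forall c, exists a, forall v, f (c *: v) = a * f v) ->
  (forall a, exists v, f v = a) -> artinian A.
Proof.
move=> fD fZ f_surj J J_ideal J_desc.
have J_le n1 n2 a : (n1 <= n2)%N -> J n2 a -> J n1 a.
  by move=> /subnK<-; elim: (n2 - n1)%N => //= k IHk /J_desc.
have mx_J k : exists M : 'M_n, forall v, J k (f v) <-> (v <= M)%MS.
  have [J0 Jlin] := J_ideal k; apply: subspace_mx_exists => [|c u v Ju Jv].
    suff -> : f 0 = 0 by [].
    by apply: (addrI (f 0)); rewrite -fD !addr0.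
  by rewrite fD; have [a ->] := fZ c; apply: Jlin.
pose rk_J d := `[< exists k (M : 'M_n),
  (forall v, J k (f v) <-> (v <= M)%MS) /\ \rank M = d >].
have ex_rk : exists d, rk_J d.
  by have [M JM] := mx_J 0%N; exists (\rank M); apply/asboolP; exists 0%N, M.
case: (ex_minnP ex_rk) => d /asboolP[N [M [JM rkM]]] d_min.
exists N => k le_Nk a; split; first exact: J_le.
have [Mk JMk] := mx_J k; have [v <-] := f_surj a; rewrite JM JMk.
have sub_Mk : (Mk <= M)%MS.
  by apply/rV_subP => w /JMk /(J_le _ _ _ le_Nk) /JM.
have : (d <= \rank Mk)%N by apply: d_min; apply/asboolP; exists k, Mk.
rewrite -rkM (geq_leqif (mxrank_leqif_sup sub_Mk)) => sub_M sub_v.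
exact: submx_trans sub_v sub_M.
Qed.

(** The vector [v] forces rank below [q], hence below [p]. This turns failure of surjectivity into
    failure of injectivity. *)
Lemma left_kernel_exists (F : fieldType) p q (M : 'M[F]_(p, q)) (v : 'cV_q) :
  (q <= p)%N -> v != 0 -> M *m v = 0 -> exists2 u : 'rV_p, u != 0 & u *m M = 0.
Proof.
move=> le_qp v_neq0 Mv.
have : kermx M != 0.
  rewrite kermx_eq0; apply/negP => /eqP rkM.
  have : row_full M by rewrite /row_full eqn_leq rank_leq_col rkM.
  case/row_fullP => B BM; case/negP: v_neq0.
  by rewrite -[v]mul1mx -BM -mulmxA Mv mulmx0.
by case/rowV0Pn => u /sub_kermxP uM u_neq0; exists u.
Qed.

(** * The quotient algebra *)

Lemma mcoeffM_mpolyX (R : comNzRingType) n (p : {mpoly R[n]})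
    (k m : 'X_{1..n}) :
  (p * 'X_[k])@_m = if (k <= m)%MM then p@_(m - k) else 0.
Proof.
case: ifP => [le_km|nle_km]; first
  by rewrite -[m in LHS](submK le_km) addmC mcoeffMX.
apply/eqP; rewrite mcoeff_eq0 (perm_mem (msuppMX p k)).
apply: contraFN nle_km => /mapP[m' _ ->]; rewrite addmC.
by apply/mnm_lepP => i; rewrite mnmDE leq_addl.
Qed.

Definition ones_mnm r : 'X_{1..r} := [multinom 1%N | i < r].

Lemma I_rr_gensE (K : fieldType) r :
  I_rr_gens K r =
  [seq 'X_[k] | k <- rcons [seq (U_(i) *+ r)%MM | i <- enum 'I_r] (ones_mnm r)].
Proof.
rewrite map_rcons -map_comp /I_rr_gens; congr rcons.
  by apply: eq_map => i /=; rewrite mpolyXn.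
rewrite -(big_morph _ (@mpolyXD r K) (@mpolyX0 r K)).
congr 'X_[_]; apply/mnmP => j.
rewrite mnm_sumE mnmE (bigD1 j) //= mnm1E eqxx big1 ?addn0 // => i.
by rewrite mnm1E => /negPf->.
Qed.

Lemma mpolyX_inj (R : nzRingType) n :
  injective (fun m : 'X_{1..n} => 'X_[m] : {mpoly R[n]}).
Proof.
move=> m1 m2 /= /(congr1 (mcoeff m1)); rewrite !mcoeffX eqxx.
by case: eqP => // _ /eqP; rewrite oner_eq0.
Qed.

Section Ideal.

Variables (K : fieldType) (r : nat) (hr : (3 <= r)%N).
Local Notation I := (I_rr_ideal K hr).
Local Notation A := {ideal_quot I}.

(** Coefficients in [ideal_gen] are a function of the generator; distinctness lets such a function
    select a single summand. *)
Lemma I_rr_gens_uniq : uniq (I_rr_gens K r).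
Proof.
rewrite I_rr_gensE (map_inj_uniq (@mpolyX_inj _ _)) rcons_uniq.
rewrite map_inj_uniq ?enum_uniq ?andbT => [|i j /mnmP/(_ j)]; last first.
  rewrite !mulmnE !mnm1E eqxx; case: eqP => //; lia.
apply/mapP => -[i _ /mnmP/(_ i)]; rewrite mnmE mulmnE mnm1E eqxx; lia.
Qed.

Lemma I_rr_gen_mul p g : g \in I_rr_gens K r -> p * g \in I.
Proof.
move=> g_in; apply/ideal_genP; exists (fun g' => if g' == g then p else 0).
rewrite (bigD1_seq g) ?I_rr_gens_uniq //= eqxx big1 ?addr0 // => g' /negPf->.
by rewrite mul0r.
Qed.

Lemma nonreduced_mnmP (m : 'X_{1..r}) :
  reflect (exists2 k, 'X_[k] \in I_rr_gens K r & (k <= m)%MM)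
    (~~ reduced_mnm m).
Proof.
rewrite /reduced_mnm negb_and !negb_exists negb_forall I_rr_gensE.
apply: (iffP orP) => [[/existsP[i]|/forallP m_pos]|[k]].
- rewrite -leqNgt => le_r; exists (U_(i) *+ r)%MM.
    rewrite (mem_map (@mpolyX_inj _ _)) mem_rcons; apply/predU1r/mapP.
    by exists i; rewrite ?mem_enum.
  apply/mnm_lepP => j; rewrite mulmnE mnm1E; case: eqP => [<-|]; lia.
- exists (ones_mnm r).
    by rewrite (mem_map (@mpolyX_inj _ _)) mem_rcons inE eqxx.
  by apply/mnm_lepP => j; rewrite mnmE lt0n.
rewrite (mem_map (@mpolyX_inj _ _)) mem_rcons inE.
case/predU1P => [->|/mapP[i _ ->]] /mnm_lepP le_m.
  by right; apply/forallP => i; have := le_m i; rewrite mnmE lt0n.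
left; apply/existsP; exists i.
by have := le_m i; rewrite mulmnE mnm1E eqxx; lia.
Qed.

(** Membership in a monomial ideal is tested term by term; the reduced monomials thus give a basis
    of [A]. *)
Lemma mem_I_rr p : (p \in I) <-> (forall m, reduced_mnm m -> p@_m = 0).
Proof.
split=> [/ideal_genP[c ->] m m_red|p0].
  rewrite raddf_sum big_seq big1 // => g.
  rewrite {1}I_rr_gensE => /mapP[k k_in ->].
  rewrite /= mcoeffM_mpolyX; case: ifP => // le_km.
  move: m_red; apply: contraTeq => _; apply/nonreduced_mnmP.
  by exists k; rewrite // I_rr_gensE map_f.
rewrite [p]mpolyE; apply: rpred_sum => m _.
have [/p0->|/nonreduced_mnmP[k k_in le_km]] := boolP (reduced_mnm m).
  by rewrite scale0r rpred0.
by rewrite -(submK le_km) mpolyXD scalerAl; apply: I_rr_gen_mul.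
Qed.

Lemma pi_I_rr_eq0 p : \pi_A p = 0 <-> p \in I.
Proof.
rewrite -[p in p \in _]subr0 Quotient.idealrBE.
split=> [h|/eqP->]; last exact: raddf0.
by apply/eqP; rewrite h raddf0.
Qed.

Lemma pi_reduced_part p :
  \pi_A p = \pi_A (\sum_(m <- msupp p | reduced_mnm m) p@_m *: 'X_[m]).
Proof.
apply/eqP; rewrite -Quotient.idealrBE {1}[p]mpolyE.
rewrite (bigID (@reduced_mnm r)) /= addrAC subrr add0r.
apply/mem_I_rr => m' m'_red; rewrite raddf_sum big1 // => m m_nred /=.
rewrite mcoeffZ mcoeffX; case: eqP => [E|]; last by rewrite mulr0.
by rewrite E m'_red in m_nred.
Qed.

(** A reduced monomial occurring in a socle element becomes nonreduced after multiplication by any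
    variable. So it has one exponent 0 and all others r - 1. *)
Lemma I_rr_level : level I.
Proof.
exists (r.-1 * r.-1)%N => a a_socle.
exists (\sum_(m <- msupp (repr a) | reduced_mnm m) (repr a)@_m *: 'X_[m]);
  last first.
  by rewrite -pi_reduced_part reprK.
rewrite big_seq_cond; apply: rpred_sum => m /andP[m_supp m_red].
apply: dhomogZ; rewrite dhomogX.
have nred i : ~~ reduced_mnm (m + U_(i))%MM.
  apply: contraL m_supp => red_i; rewrite -mcoeff_eq0 -(mcoeffMX _ U_(i)) addmC.
  suff /mem_I_rr-> : repr a * 'X_i \in I by [].
  apply/pi_I_rr_eq0; rewrite mulrC rmorphM /= reprK; apply: (a_socle 1%N) => //.
  by exists 'X_i => //; rewrite dhomogX /= mdeg1.
case/andP: m_red => /forallP m_lt /existsP[j /eqP mj].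
(* Multiplying by another variable keeps the exponent at [j] zero, so some exponent must reach
   [r]. *)
have m_eq i : i != j -> m i = r.-1.
  move=> neq_ij; have := nred i; rewrite negb_and orbC; case/orP.
    case/negP; apply/existsP; exists j.
    by rewrite mnmDE mnm1E mj (negPf neq_ij).
  rewrite negb_forall => /existsP[l]; rewrite -leqNgt mnmDE mnm1E.
  by have := m_lt l; case: eqP => [<-|_]; lia.
rewrite /= mdegE (bigD1 j) //= mj add0n (eq_bigr _ m_eq) sum_nat_const.
by rewrite cardC1 card_ord.
Qed.

Lemma I_rr_artinian : artinian A.
Proof.
pose T : finType := {ffun 'I_r -> 'I_r}.
pose lin (v : 'rV[K]_#|T|) : {mpoly K[r]} :=
  \sum_(a : T) v 0 (enum_rank a) *: 'X_[ffun_mnm a].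
apply: (artinian_finite_dim (f := fun v => \pi_A (lin v))) => [u v|c|a].
- rewrite -raddfD -big_split; congr (\pi _); apply: eq_bigr => a _.
  by rewrite mxE scalerDl.
- exists (\pi_A c%:MP) => v; rewrite -rmorphM mulr_sumr; congr (\pi _).
  by apply: eq_bigr => a _; rewrite mxE mul_mpolyC scalerA.
exists (\row_k (repr a)@_(ffun_mnm (enum_val k))).
rewrite -[RHS]reprK; apply/eqP; rewrite -Quotient.idealrBE; apply/mem_I_rr => m.
move=> /reduced_ffun_mnm[b ->].
rewrite mcoeffB raddf_sum (bigD1 b) //= mcoeffZ mcoeffX eqxx mulr1 mxE.
rewrite enum_rankK.
rewrite big1 ?addr0 ?subrr // => a' neq; rewrite mcoeffZ mcoeffX.
by rewrite (inj_eq (@ffun_mnm_inj _)) (negPf neq) mulr0.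
Qed.

End Ideal.

Lemma dhomog1E (R : comNzRingType) n (l : {mpoly R[n]}) :
  l \is 1.-homog -> l = \sum_i l@_(U_(i)) *: 'X_i.
Proof.
move=> l_homog; apply/mpolyP => m; rewrite raddf_sum /=.
under eq_bigr => i _ do rewrite mcoeffZ mcoeffX.
have [/mdeg1P[i /eqP->]|m_deg] := boolP (mdeg m == 1%N).
  rewrite (bigD1 i) //= eqxx mulr1 big1 ?addr0 // => j neq_ji.
  case: eqP => [/mnmP/(_ j)|]; last by rewrite mulr0.
  by rewrite !mnm1E eqxx eq_sym (negPf neq_ji).
rewrite (dhomog_nemf_coeff l_homog m_deg) big1 // => i _.
by case: eqP => [E|]; [rewrite -E mdeg1 in m_deg | rewrite mulr0].
Qed.

(** * Failure of the weak Lefschetz property *)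

(** The linear extension of a [phi] supported on the reduced monomials of degree ['C(r, 2)]; the
    fixed index set makes linearity immediate. *)
Definition mnm_functional (K : fieldType) r (phi : 'X_{1..r} -> K)
    (p : {mpoly K[r]}) : K :=
  \sum_(a in reduced_exponents r 'C(r, 2))
     p@_(ffun_mnm a) * phi (ffun_mnm a).

Lemma mnm_functional_is_scalar (K : fieldType) r (phi : 'X_{1..r} -> K) :
  scalar (mnm_functional phi).
Proof.
move=> c p q; rewrite /mnm_functional mulr_sumr -big_split /=.
by apply: eq_bigr => a _; rewrite mcoeffD mcoeffZ mulrDl mulrA.
Qed.

HB.instance Definition _ (K : fieldType) r (phi : 'X_{1..r} -> K) :=
  GRing.isLinear.Build K {mpoly K[r]} K *%R (mnm_functional phi)
    (mnm_functional_is_scalar phi).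

Section WeakLefschetz.

Variables (K : fieldType) (r : nat) (hr : (3 <= r)%N).
Local Notation I := (I_rr_ideal K hr).
Local Notation A := {ideal_quot I}.
Local Notation d := 'C(r, 2).

Variables (phi : 'X_{1..r} -> K) (l : {mpoly K[r]}).
Hypothesis phi_support :
  forall m, phi m != 0 -> reduced_mnm m /\ mdeg m = d.
Hypothesis phi_l : forall m, \sum_i l@_(U_(i)) * phi (m + U_(i))%MM = 0.
Hypothesis l_homog : l \is 1.-homog.

Local Notation functional := (mnm_functional phi).

Lemma functionalX m : functional 'X_[m] = phi m.
Proof.
rewrite /mnm_functional; under eq_bigr => a _ do rewrite mcoeffX.
have [phi0|phi_neq0] := eqVneq (phi m) 0.
  rewrite phi0 big1 // => a _; case: eqP => [<-|]; last by rewrite mul0r.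
  by rewrite phi0 mulr0.
have [m_red m_deg] := phi_support phi_neq0.
have [a Em] := reduced_ffun_mnm m_red; rewrite Em in m_red m_deg *.
rewrite (bigD1 a) /=; last by rewrite mem_reduced_exponents m_red m_deg eqxx.
rewrite eqxx mul1r big1 ?addr0 // => b /andP[_ neq_ba].
by rewrite (inj_eq (@ffun_mnm_inj _)) eq_sym (negPf neq_ba) mul0r.
Qed.

Lemma functional_mulX m : functional (l * 'X_[m]) = 0.
Proof.
rewrite {1}(dhomog1E l_homog) mulr_suml.
under eq_bigr => i _ do rewrite -scalerAl -mpolyXD addmC.
rewrite linear_sum -[RHS](phi_l m).
by apply: eq_bigr => i _; rewrite linearZ /= functionalX.
Qed.

Lemma functional_mul p : functional (l * p) = 0.
Proof.
rewrite [p]mpolyE mulr_sumr; under eq_bigr => m _ do rewrite -scalerAr.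
by rewrite linear_sum big1 // => m _; rewrite linearZ /= functional_mulX mulr0.
Qed.

Lemma functional_ideal p : p \in I -> functional p = 0.
Proof.
move/mem_I_rr => p0; apply: big1 => a.
by rewrite mem_reduced_exponents => /andP[/p0-> _]; rewrite mul0r.
Qed.

Hypothesis phi_neq0 : exists m, phi m != 0.

(** The functional kills [I] and all multiples of [l], but not some monomial of degree [d]. *)
Lemma mul_not_surjective : ~ mul_surjective_on d.-1 (\pi_A l).
Proof.
have d_gt0 : (0 < d)%N by rewrite bin_gt0; lia.
have [m m_neq0] := phi_neq0; have [_ m_deg] := phi_support m_neq0.
move=> /(_ (\pi_A 'X_[m])); rewrite prednK // => -[|a _].
  by exists 'X_[m]; rewrite // dhomogX /= m_deg.
rewrite -[a]reprK -rmorphM => /eqP; rewrite -Quotient.idealrBE => in_I.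
have /eqP := functional_ideal in_I.
by rewrite linearB /= functional_mul functionalX sub0r oppr_eq0 (negPf m_neq0).
Qed.

Lemma mul_not_injective : ~ mul_injective_on d.-1 (\pi_A l).
Proof.
have d_gt0 : (0 < d)%N by rewrite bin_gt0; lia.
pose C := reduced_exponents r d.-1; pose D := reduced_exponents r d.
pose M : 'M[K]_(#|C|, #|D|) := \matrix_(j, k)
  (l * 'X_[ffun_mnm (enum_val j)])@_(ffun_mnm (enum_val k)).
pose v : 'cV[K]_#|D| := \col_k phi (ffun_mnm (enum_val k)).
(* [M] is the matrix of multiplication by [l] in the reduced monomial bases; [M *m v] lists the
   functional at the products of [l] with basis monomials, so it is 0. *)
have [|||u u_neq0 uM] := @left_kernel_exists _ _ _ M v.
- exact: leq_card_reduced_exponents.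
- have [m m_neq0] := phi_neq0; have [m_red m_deg] := phi_support m_neq0.
  have [a Em] := reduced_ffun_mnm m_red; rewrite Em in m_neq0 m_red m_deg.
  have a_in : a \in D by rewrite mem_reduced_exponents m_red m_deg eqxx.
  apply: contra m_neq0 => /eqP/matrixP/(_ (enum_rank_in a_in a) 0).
  by rewrite !mxE enum_rankK_in // => ->.
- apply/matrixP => j k; rewrite !mxE.
  rewrite -[RHS](functional_mulX (ffun_mnm (enum_val j))).
  rewrite /mnm_functional [RHS]big_enum_val; apply: eq_bigr => i _.
  by rewrite !mxE.
pose p := \sum_j u 0 j *: 'X_[ffun_mnm (enum_val j)] : {mpoly K[r]}.
have p_homog : p \is (d.-1).-homog.
  apply: rpred_sum => j _; apply: dhomogZ; rewrite dhomogX /=.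
  by have := enum_valP j; rewrite mem_reduced_exponents => /andP[_].
have lp_in : l * p \in I.
  apply/mem_I_rr => m m_red.
  have [m_deg|] := eqVneq (mdeg m) d; last first.
    by apply: dhomog_nemf_coeff; rewrite -(prednK d_gt0) -add1n; apply: dhomogM.
  have [a Em] := reduced_ffun_mnm m_red; rewrite Em in m_red m_deg *.
  have a_in : a \in D by rewrite mem_reduced_exponents m_red m_deg eqxx.
  move/matrixP/(_ 0 (enum_rank_in a_in a)): uM; rewrite !mxE => <-.
  rewrite mulr_sumr raddf_sum; apply: eq_bigr => j _.
  by rewrite !mxE enum_rankK_in //= -scalerAr mcoeffZ.
move=> /(_ (\pi_A p) 0) l_inj.
have /pi_I_rr_eq0/mem_I_rr p0 : \pi_A p = 0.
  apply: l_inj; first by exists p.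
    by exists 0; rewrite ?rpred0 ?raddf0.
  by rewrite mulr0 -rmorphM; apply/pi_I_rr_eq0.
(* The entries of [u] are coefficients of [p] at reduced monomials, hence vanish once [p] is in
   [I]. *)
case/negP: u_neq0; apply/eqP/rowP => j; rewrite mxE.
have := enum_valP j; rewrite mem_reduced_exponents => /andP[/p0 <- _].
rewrite raddf_sum (bigD1 j) //= mcoeffZ mcoeffX eqxx mulr1 big1 ?addr0 // => k.
rewrite mcoeffZ mcoeffX (inj_eq (@ffun_mnm_inj _)) (inj_eq enum_val_inj).
by move/negPf->; rewrite mulr0.
Qed.

End WeakLefschetz.

Theorem theorem4p3 (K : fieldType) (r : nat) (hr : (3 <= r)%N) :
  [/\ artinian {ideal_quot (I_rr_ideal K hr)},
      level (I_rr_ideal K hr)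
    & ~ weak_lefschetz (I_rr_ideal K hr)].
Proof.
split; [exact: I_rr_artinian | exact: I_rr_level | case=> _ [l l_homog ->] wl].
have r_gt0 : (0 < r)%N by lia.
(* The functional is built from the coefficients of the given [l], any of which may be zero. *)
have [phi [phi_neq0 phi_supp phi_l]] :=
  alternating_functional_exists (fun i : 'I_r => l@_(U_(i))) r_gt0.
case: (wl ('C(r, 2).-1)).
  exact: (mul_not_injective (phi := phi)).
exact: (mul_not_surjective (phi := phi)).
Qed.
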